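(* Let $\mathcal{A}$ be a unital complex Banach $*$-algebra with proper involution, and let $a,b,c\in\mathcal{A}$. Then $a\in\mathcal{A}_{b,c}^{\mathrm{gg}}$ if and only if $a\in\mathcal{A}^{\mathrm{gg}}$ and $cab$ has an inner inverse $(cab)^{-}$ such that $$a^{\mathrm{gg}}=b(cab)^{-}c,\quad b(cab)^{-}(cab)=b,\quad (cab)(cab)^{-}c=c.$$
   Context: An involution on a complex Banach algebra $\mathcal{A}$ is a map $x\mapsto x^*$ with $(x+y)^*=x^*+y^*$, $(\lambda x)^*=\overline{\lambda}x^*$, $(xy)^*=y^*x^*$, $(x^* )^*=x$; it is proper if $x^*x=0$ implies $x=0$. An inner inverse of $x\in\mathcal{A}$ is an element $x^{-}$ with $xx^{-}x=x$. $(b,c)$-inverse: $a$ has a $(b,c)$-inverse if there is $x$ with $xab=b$, $cax=c$, $x\in b\mathcal{A}x\cap x\mathcal{A}c$; it is unique, denoted $a^{(b,c)}$. Generalized group inverse: $a\in\mathcal{A}^{\mathrm{gg}}$ if there is $x$ with $x=ax^2$, $(a^*a^2x)^*=a^*a^2x$, $\lim_{n\to\infty}\|a^n-xa^{n+1}\|^{1/n}=0$; it is unique, denoted $a^{\mathrm{gg}}$. $\mathcal{A}_{b,c}^{\mathrm{gg}}$ is the set of $a\in\mathcal{A}^{\mathrm{gg}}$ such that $a^{(b,c)}$ exists and $a^{\mathrm{gg}}=a^{(b,c)}$. *)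

(* Defs.v *)
From HB Require Import structures.
From mathcomp Require Import all_boot all_order all_algebra.
From mathcomp Require Import all_classical all_reals all_analysis.
From mathcomp Require Import complex.

Set Implicit Arguments.
Unset Strict Implicit.
Unset Printing Implicit Defensive.

Import Order.TTheory GRing.Theory Num.Theory.
Import numFieldNormedType.Exports.

Local Open Scope classical_set_scope.
Local Open Scope ring_scope.

(* Hierarchy-Builder rejects a join of [algType] with a normed module, because
   [numDomainType] already joins rings with norms.  The norm is therefore an
   explicit real-valued function; [ComplexField.Normc.normc] is the modulus of
   a complex number as an element of [R].  [bnorm 1 = 1] is not required. *)
HB.mixin Record Algebra_isBanach (R : realType) A & GRing.Algebra R[i] A := {
  bnorm : A -> R;
  bnormD : forall x y, bnorm (x + y) <= bnorm x + bnorm y;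
  bnormZ : forall (l : R[i]) x,
    bnorm (l *: x) = ComplexField.Normc.normc l * bnorm x;
  bnorm0_eq0 : forall x, bnorm x = 0 -> x = 0;
  bnormM : forall x y, bnorm (x * y) <= bnorm x * bnorm y;
  bnorm_complete : forall u : nat -> A,
    (forall e : R, 0 < e -> exists N : nat,
       forall m n : nat, (N <= m)%N -> (N <= n)%N -> bnorm (u m - u n) < e) ->
    exists l : A, bnorm (u n - l) @[n --> \oo] --> (0 : R)
}.

#[short(type="banachAlgType")]
HB.structure Definition BanachAlgebra (R : realType) :=
  {A of GRing.Algebra R[i] A & Algebra_isBanach R A}.

(* No compatibility between the involution and the norm is assumed. *)
HB.mixin Record BanachAlgebra_hasInvolution (R : realType) A
    & BanachAlgebra R A := {
  star : A -> A;
  starD : forall x y, star (x + y) = star x + star y;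
  starZ : forall (l : R[i]) x, star (l *: x) = l^* *: star x;
  starM : forall x y, star (x * y) = star y * star x;
  starK : forall x, star (star x) = x
}.

#[short(type="banachStarAlgType")]
HB.structure Definition BanachStarAlgebra (R : realType) :=
  {A of BanachAlgebra R A & BanachAlgebra_hasInvolution R A}.

Section BanachTheory.
Variables (R : realType) (A : banachAlgType R).
Implicit Types (x z : A).

Lemma bnorm0 : bnorm (0 : A) = 0.
Proof. by rewrite -(scale0r (0 : A)) bnormZ ComplexField.Normc.normc0 mul0r. Qed.

Lemma bnormN x : bnorm (- x) = bnorm x.
Proof.
by rewrite -scaleN1r bnormZ normcN ComplexField.Normc.normc1 mul1r.
Qed.

Lemma bnorm_ge0 x : 0 <= bnorm x.
Proof. by have := bnormD x (- x); rewrite subrr bnorm0 bnormN -mulr2n pmulrn_lge0. Qed.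

Lemma bnormX x n : bnorm (x ^+ n.+1) <= bnorm x ^+ n.+1.
Proof.
elim: n => [|n IHn]; first by rewrite !expr1.
rewrite exprS [leRHS]exprS (le_trans (bnormM _ _))//.
by rewrite ler_wpM2l ?bnorm_ge0.
Qed.

Lemma quasinilpotent_seq_eq0 (u : nat -> A) x y z :
    bnorm (u n) `^ n%:R^-1 @[n --> \oo] --> (0 : R) ->
  (forall n, z = u n * (y * x ^+ n.+1)) -> z = 0.
Proof.
move=> u0 zE; apply: bnorm0_eq0; apply/eqP; rewrite eq_le bnorm_ge0 andbT.
pose C := bnorm x + 1; have C_gt0 : 0 < C by rewrite ltr_wpDl ?bnorm_ge0.
have half_cvg : bnorm y * C * 2^-1 ^+ n @[n --> \oo] --> (0 : R).
  rewrite -(mulr0 (bnorm y * C)); apply: cvgMl_tmp; apply: cvg_expr.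
  by rewrite ger0_norm ?invr_ge0// invf_lt1// ltr1n.
apply: (ler_cvg_to (cvg_cst (bnorm z)) half_cvg).
have e_gt0 : 0 < (2 * C)^-1 by rewrite invr_gt0 mulr_gt0.
near=> n.
have n_gt0 : (0 < n)%N by near: n; exact: nbhs_infty_gt.
have un : bnorm (u n) <= (2 * C)^-1 ^+ n.
  have rootn : bnorm (u n) `^ n%:R^-1 <= (2 * C)^-1.
    apply: le_trans (ler_norm _) _; near: n.
    by have /cvgr0_norm_le := u0; apply.
  have -> : bnorm (u n) = (bnorm (u n) `^ n%:R^-1) ^+ n.
    rewrite -powR_mulrn ?powR_ge0// -powRrM mulVf ?powRr1 ?bnorm_ge0//.
    by rewrite pnatr_eq0 -lt0n.
  by apply: lerXn2r; rewrite ?nnegrE ?powR_ge0 ?(ltW e_gt0).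
rewrite (zE n) (le_trans (bnormM _ _))//.
apply: (@le_trans _ _ ((2 * C)^-1 ^+ n * (bnorm y * C ^+ n.+1))).
  rewrite ler_pM ?bnorm_ge0// (le_trans (bnormM _ _))// ler_wpM2l ?bnorm_ge0//.
  rewrite (le_trans (bnormX _ _))//.
  by apply: lerXn2r; rewrite ?nnegrE ?bnorm_ge0 ?(ltW C_gt0)// lerDl.
rewrite [leLHS](_ : _ = bnorm y * C * ((2 * C)^-1 * C) ^+ n); last first.
  by rewrite exprMn exprS mulrC -!mulrA [C ^+ n * _]mulrC.
by rewrite invfM divfK// gt_eqF.
Unshelve. all: by end_near. Qed.

End BanachTheory.

Section Inverses.
Variables (R : realType) (A : banachStarAlgType R).
Implicit Types a b c x g : A.

Definition proper_involution := forall x, star x * x = 0 -> x = 0.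

Definition is_inner_inverse x g := x * g * x = x.

Definition is_bc_inverse b c a x :=
  [/\ x * a * b = b, c * a * x = c,
      exists y, x = b * y * x & exists z, x = x * z * c].

Definition bc_invertible b c : set A :=
  [set a | exists x, is_bc_inverse b c a x].

Definition bc_inverse b c a : A := xget 0 (is_bc_inverse b c a).

(* The sequence starts at [n = 0], where the exponent [0^-1] is [0]; the limit
   ignores this term. *)
Definition is_gg_inverse a x :=
  [/\ x = a * x ^+ 2,
      star (star a * a ^+ 2 * x) = star a * a ^+ 2 * x
    & bnorm (a ^+ n - x * a ^+ n.+1) `^ n%:R^-1 @[n --> \oo] --> (0 : R)].

Definition gg_invertible : set A := [set a | exists x, is_gg_inverse a x].

Definition gg_inverse a : A := xget 0 (is_gg_inverse a).

Definition gg_bc_invertible b c : set A :=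
  [set a | [/\ gg_invertible a, bc_invertible b c a
             & gg_inverse a = bc_inverse b c a]].

(* The two uniqueness lemmas make the choices in [bc_inverse] and [gg_inverse]
   canonical. *)
Lemma bc_inverse_unique b c a x y :
  is_bc_inverse b c a x -> is_bc_inverse b c a y -> x = y.
Proof.
move=> [_ cax [u xu] _] [yab _ _ [v yv]].
have yax : y * a * x = x by rewrite xu !mulrA yab.
by rewrite -yax [in LHS]yv -!mulrA (mulrA c) cax [RHS]yv !mulrA.
Qed.

Lemma gg_inverse_unique a x y : proper_involution ->
  is_gg_inverse a x -> is_gg_inverse a y -> x = y.
Proof.
move=> properA ax ay.
have powE w : w = a * w ^+ 2 -> forall n, w = a ^+ n * w ^+ n.+1.
  move=> wE; elim=> [|n IHn]; first by rewrite mul1r expr1.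
  by rewrite exprSr -(add2n n) exprD -mulrA (mulrA a) -wE -exprS.
have absorb v w : is_gg_inverse a v -> is_gg_inverse a w ->
    w = v * a * w /\ a * w = v * a ^+ 2 * w.
  move=> [_ _ v0] [wE _ _].
  split; apply/eqP; rewrite -subr_eq0; apply/eqP.
  - apply: (quasinilpotent_seq_eq0 (x := w) (y := 1) v0) => n.
    by rewrite mul1r mulrBl -(powE w wE) (exprS a) -!mulrA -(powE w wE).
  - apply: (quasinilpotent_seq_eq0 (x := w) (y := a) v0) => n.
    have aw : a ^+ n * (a * w ^+ n.+1) = a * w.
      by rewrite mulrA -exprSr exprS -mulrA -(powE w wE).
    by rewrite expr2 mulrBl (exprS a n) -!mulrA aw.
have [[_ xh _] [_ yh _]] := (ax, ay).
have [xax axE] := absorb _ _ ax ax.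
have [xay ayE] := absorb _ _ ax ay.
have [yax _] := absorb _ _ ay ax.
have pq : a * x * (a * y) = a * y by rewrite -mulrA (mulrA x) -xay.
have qp : a * y * (a * x) = a * x by rewrite -mulrA (mulrA y) -yax.
pose s := star a * a.
have shift w : star (star a * a ^+ 2 * w) = star a * a ^+ 2 * w ->
    star (a * w) * s = s * (a * w).
  have -> : star a * a ^+ 2 * w = s * (a * w) by rewrite /s expr2 !mulrA.
  by move=> h; rewrite -[RHS]h (starM s) /s (starM (star a)) starK.
have spq : s * (a * y) = s * (a * x).
  by rewrite -{1}pq mulrA -(shift x xh) -mulrA -(shift y yh) mulrA -starM qp.
have sd0 : s * (a * y - a * x) = 0 by rewrite mulrBr spq subrr.
have /properA/eqP : star (a * (a * y - a * x)) * (a * (a * y - a * x)) = 0.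
  by rewrite starM -mulrA (mulrA (star a)) sd0 mulr0.
rewrite mulrBr subr_eq0 => /eqP aay.
have ayx : a * y = a * x.
  by rewrite ayE axE expr2 -!mulrA aay.
by rewrite xax -mulrA -ayx mulrA -xay.
Qed.

Lemma bc_inverseE b c a x : is_bc_inverse b c a x -> bc_inverse b c a = x.
Proof. by move=> ax; apply: xget_unique => // y /bc_inverse_unique; apply. Qed.

Lemma gg_inverseE a x : proper_involution ->
  is_gg_inverse a x -> gg_inverse a = x.
Proof.
by move=> pA ax; apply: xget_unique => // y /(gg_inverse_unique pA); apply.
Qed.

End Inverses.

(* Main.v *)
Require Import Defs.
From mathcomp Require Import all_boot all_order all_algebra.
From mathcomp Require Import all_classical all_reals all_analysis.

(** The generalized group inverse enters only as a given element: the content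
    is the description, for any [x], of when [x] is the (b,c)-inverse of [a]
    ([is_bc_inverseP]), and this is pure ring algebra.  If [x = b y x] and
    [x = x z c], then substituting one equation into the other sandwiches [x]
    between [b] and [c], as [x = b (y x z) c]; so [g = y x z] turns the
    equations [x a b = b] and [c a x = c] into the required identities.
    Conversely, for [x = b g c], the identity [c a b g c = c] lets a copy of
    [x] be split off on either side: [x = b (g c a) x = x (a b g) c].
    The theorem is this description at [x = gg_inverse a], combined with the
    uniqueness of (b,c)-inverses. *)

Import GRing.Theory.

Local Open Scope ring_scope.

Lemma is_bc_inverseP (R : realType) (A : banachStarAlgType R) (a b c x : A) :
  is_bc_inverse b c a x <->
  exists g : A,
    [/\ is_inner_inverse (c * a * b) g,
        x = b * g * c,
        b * g * (c * a * b) = b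
      & (c * a * b) * g * c = c].
Proof.
split=> [[xab cax [y xE] [z xE']]|[g [_ xE bg gc]]].
  have bgc : x = b * (y * x * z) * c by rewrite !mulrA -xE -xE'.
  have bg : b * (y * x * z) * (c * a * b) = b.
    by rewrite -[c * a * b]mulrA mulrA -bgc mulrA.
  exists (y * x * z); split=> //.
    by rewrite /is_inner_inverse -mulrA -[X in X = _]mulrA (mulrA b) bg.
  by rewrite -[c * a * b * _]mulrA -mulrA -bgc.
split.
- by rewrite xE -[RHS]bg !mulrA.
- by rewrite xE -[RHS]gc !mulrA.
- by exists (g * c * a); rewrite xE -[in LHS]gc !mulrA.
- by exists (a * b * g); rewrite xE -[in LHS]gc !mulrA.
Qed.

Theorem theorem4p1 (R : realType) (A : banachStarAlgType R)
    (properA : proper_involution A) (a b c : A) :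
  gg_bc_invertible b c a <->
  gg_invertible a /\
  exists g : A,
    [/\ is_inner_inverse (c * a * b) g,
        gg_inverse a = b * g * c,
        b * g * (c * a * b) = b
      & (c * a * b) * g * c = c].
Proof.
split=> [[gga [x bcx] eq_inv]|[gga /is_bc_inverseP bcx]].
  by split=> //; apply/is_bc_inverseP; rewrite eq_inv (bc_inverseE bcx).
by split=> //; [exists (gg_inverse a) | rewrite (bc_inverseE bcx)].
Qed.
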